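(* Let $(X,Y)$ be a pair of random variables on finite sets $\mathcal{X}\times\mathcal{Y}$ inducing a pair of stationary memoryless sources, let $\hat{\mathcal{X}}$ be a finite set, and let $c:\mathcal{X}\times\hat{\mathcal{X}}\to[0,\infty)$ be an arbitrary function inducing the additive cost $c_n(x^n,\hat x^n)=\frac1n\sum_{i=1}^nc(x_i,\hat x_i)$. Let $\tilde x\in\arg\min_{\hat x\in\hat{\mathcal{X}}}\mathrm{E}[c(X,\hat x)]$ and, for $n\ge1$, let $f_n^{(\mathrm r)}:\mathcal{X}^n\to\hat{\mathcal{X}}^n$ be the constant deterministic encoder $f_n^{(\mathrm r)}(x^n)=(\tilde x,\dots,\tilde x)$ for all $x^n\in\mathcal{X}^n$. If $Y$ is not weakly independent of $X$, then for every integer $n\ge1$, $$I(Y^n;f_n^{(\mathrm r)}(X^n))=0\quad\text{and}\quad \mathrm{E}[c_n(X^n,f_n^{(\mathrm r)}(X^n))]=C_{\rm a}^*(n,0).$$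
   Context: $\mathcal{X},\mathcal{Y},\hat{\mathcal{X}}$ are finite nonempty sets; $I(\cdot;\cdot)$ is mutual information. The stationary memoryless sources induced by $(X,Y)$: $(X_1,Y_1),(X_2,Y_2),\dots$ are independent copies of $(X,Y)$, and $X^n=(X_1,\dots,X_n)$, $Y^n=(Y_1,\dots,Y_n)$. Weak independence (Berger–Yeung): $Y$ is weakly independent of $X$ if the rows $P_{Y|X}(\cdot|x)=(P_{Y|X}(y|x):y\in\mathcal{Y})$, $x\in\mathcal{X}$, of the stochastic matrix $P_{Y|X}$ are linearly dependent. A stochastic encoder $f_n:\mathcal{X}^n\to\hat{\mathcal{X}}^n$ is a random map, i.e. given by a conditional probability distribution on $\hat{\mathcal{X}}^n$ given $x^n\in\mathcal{X}^n$; its output $f_n(X^n)$ depends on $(X^n,Y^n)$ only through $X^n$, so $Y^n-X^n-f_n(X^n)$ is a Markov chain. For an integer $n\ge1$ and reals $\Gamma,\epsilon\ge0$, $\Gamma$ is $(n,\epsilon)$-strongly achievable in the sense of the average cost if there exists a stochastic encoder $f_n$ with $I(Y^n;f_n(X^n))\le\epsilon$ and $\mathrm{E}[c_n(X^n,f_n(X^n))]\le\Gamma$. Define $C_{\rm a}^*(n,\epsilon)=\inf\{\Gamma\ge 0:\Gamma\text{ is }(n,\epsilon)\text{-strongly achievable in the sense of the average cost}\}$. *)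

(* Defs.v *)
From mathcomp Require Import all_boot all_order all_algebra.
From mathcomp Require Import all_classical all_reals all_analysis.

Set Implicit Arguments.
Unset Strict Implicit.
Unset Printing Implicit Defensive.

Import Order.TTheory GRing.Theory Num.Theory.
Local Open Scope classical_set_scope.
Local Open Scope ring_scope.

(* Random variables on a finite probability space (T, p) are plain functions
   on T, and p is a probability mass function. *)
Definition is_dist (R : realType) (T : finType) (p : T -> R) : Prop :=
  (forall t, 0 <= p t) /\ \sum_t p t = 1.

Definition law (R : realType) (T U : finType) (p : T -> R) (f : T -> U)
    (u : U) : R :=
  \sum_(t | f t == u) p t.

Definition expect (R : realType) (T : finType) (p : T -> R) (g : T -> R) : R :=
  \sum_t p t * g t.

(* Mutual information in nats; the convention 0 * log (0 / q) = 0 holds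
   because the factor in front of the logarithm vanishes. *)
Definition mutual_info (R : realType) (T U V : finType) (p : T -> R)
    (f : T -> U) (g : T -> V) : R :=
  \sum_u \sum_v
    law p (fun t => (f t, g t)) (u, v) *
    ln (law p (fun t => (f t, g t)) (u, v) / (law p f u * law p g v)).

Section Source.
Variables (R : realType) (X Y Xhat : finType).

Definition is_stochastic (A B : finType) (K : A -> B -> R) : Prop :=
  forall a, is_dist (K a).

(* W is the stochastic matrix P_{Y|X} of the pair with joint law P; its rows at
   the x with P_X(x) = 0, if any, can be arbitrary distributions. *)
Definition is_cond_law (P : X * Y -> R) (W : X -> Y -> R) : Prop :=
  is_stochastic W /\ forall x y, P (x, y) = law P fst x * W x y.

(* [free] is about families: repeated rows count as linearly dependent. *)
Definition weakly_independent (W : X -> Y -> R) : Prop :=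
  ~~ free [seq ([ffun y => W x y] : {ffun Y -> R^o}) | x : X].

Definition is_encoder (n : nat)
    (f : {ffun 'I_n -> X} -> {ffun 'I_n -> Xhat} -> R) : Prop :=
  is_stochastic f.

Definition det_encoder (n : nat)
    (g : {ffun 'I_n -> X} -> {ffun 'I_n -> Xhat}) :
    {ffun 'I_n -> X} -> {ffun 'I_n -> Xhat} -> R :=
  fun x z => (z == g x)%:R.

Definition const_encoder (n : nat) (z : Xhat) :
    {ffun 'I_n -> X} -> {ffun 'I_n -> Xhat} -> R :=
  det_encoder (fun _ => [ffun _ => z]).

(* Sample space carrying (X^n, Y^n, f_n(X^n)). *)
Definition sample (n : nat) : finType :=
  ({ffun 'I_n -> X} * {ffun 'I_n -> Y} * {ffun 'I_n -> Xhat})%type.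

Definition source_x (n : nat) (w : sample n) : {ffun 'I_n -> X} := w.1.1.
Definition source_y (n : nat) (w : sample n) : {ffun 'I_n -> Y} := w.1.2.
Definition output (n : nat) (w : sample n) : {ffun 'I_n -> Xhat} := w.2.

(* The pairs (X_i, Y_i) are i.i.d. with law P, and given (X^n, Y^n) the encoder
   output is drawn from f (X^n), whence Y^n - X^n - f_n(X^n). *)
Definition system_law (P : X * Y -> R) (n : nat)
    (f : {ffun 'I_n -> X} -> {ffun 'I_n -> Xhat} -> R) (w : sample n) : R :=
  (\prod_(i < n) P (source_x w i, source_y w i)) * f (source_x w) (output w).

Definition leakage (P : X * Y -> R) (n : nat)
    (f : {ffun 'I_n -> X} -> {ffun 'I_n -> Xhat} -> R) : R :=
  mutual_info (system_law P f) (@source_y n) (@output n).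

Definition additive_cost (c : X -> Xhat -> R) (n : nat)
    (x : {ffun 'I_n -> X}) (z : {ffun 'I_n -> Xhat}) : R :=
  n%:R^-1 * \sum_(i < n) c (x i) (z i).

Definition average_cost (P : X * Y -> R) (c : X -> Xhat -> R) (n : nat)
    (f : {ffun 'I_n -> X} -> {ffun 'I_n -> Xhat} -> R) : R :=
  expect (system_law P f)
    (fun w => additive_cost c (source_x w) (output w)).

Definition strongly_achievable (P : X * Y -> R) (c : X -> Xhat -> R)
    (n : nat) (eps Gamma : R) : Prop :=
  exists f : {ffun 'I_n -> X} -> {ffun 'I_n -> Xhat} -> R,
    [/\ is_encoder f, leakage P f <= eps & average_cost P c f <= Gamma].

(* For eps >= 0 and Xhat nonempty this set is nonempty and bounded below, so
   that [inf] is the genuine infimum. *)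
Definition Ca_star (P : X * Y -> R) (c : X -> Xhat -> R)
    (n : nat) (eps : R) : R :=
  inf [set Gamma : R | 0 <= Gamma /\ strongly_achievable P c n eps Gamma].

End Source.

Arguments const_encoder R {X Xhat} n z _ _.

(* Main.v *)
(** Zero leakage forces P(y^n, z) = P(y^n) P(z) by the equality case of Gibbs'
    inequality, that is, with Q the law of X^n and W = P_{Y|X},
    [sum_x Q(x) (f(z|x) - P(z)) prod_i W(x_i, y_i) = 0] for all y and z.
    The rows of W are independent, so W has a right inverse, whose n-fold tensor
    power inverts that of W: hence Q(x) f(z|x) = Q(x) P(z), and the output is
    already independent of X^n.  The cost is then an average over z of
    [1/n sum_i E c(X, z_i)], each term of which is at least E c(X, xt). *)

Require Import Defs.
From mathcomp Require Import all_boot all_order all_algebra.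
From mathcomp Require Import all_classical all_reals all_analysis.

Set Implicit Arguments.
Unset Strict Implicit.
Unset Printing Implicit Defensive.

Import Order.TTheory GRing.Theory Num.Theory.
Local Open Scope ring_scope.

(** * Equality case of Gibbs' inequality *)

(** This is [1 + ln t <= t] at [t = q / p], scaled by [p], with equality only at [t = 1]. For
    [p = 0] the logarithmic term vanishes and only [- q <= 0] is left. *)
Lemma subr_le_mul_ln (R : realType) (p q : R) :
  0 <= p -> 0 <= q -> (q = 0 -> p = 0) ->
  p - q <= p * ln (p / q) ?= iff (p == q).
Proof.
move=> p0 q0 ac; have [->|pN0] := eqVneq p 0.
  by rewrite mul0r sub0r; split; rewrite ?oppr_le0// oppr_eq0 eq_sym.
have qN0 : q != 0 by apply: contraNneq pN0 => /ac ->.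
have p_gt0 : 0 < p by rewrite lt0r pN0.
have q_gt0 : 0 < q by rewrite lt0r qN0.
have [->|pq] := eqVneq p q.
  by rewrite divff// ln1 mulr0 subrr; exact/leifP.
apply/leifP; rewrite -[X in X < _]opprB -[X in _ < X]opprK ltrN2 -mulrN.
rewrite -lnV ?posrE ?divr_gt0// invf_div -ltr_pdivlMl// mulrBr mulVf//.
rewrite [p^-1 * q]mulrC ltrBrDr.
(* The exponential lies strictly above its tangent at 0 only away from 0, so [p != q] must first
   give a nonzero logarithm. *)
have l0 : ln (q / p) != 0.
  rewrite ln_eq0 ?divr_gt0//; apply: contraNneq pq => qp1.
  by rewrite -[q](divfK pN0) qp1 mul1r.
by rewrite addrC -[X in _ < X]lnK ?posrE ?divr_gt0//; exact: expR_gt1Dx.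
Qed.

(** With equal total masses the lower bounds [p i - q i] sum to 0, so a nonpositive divergence
    leaves no slack in any term. *)
Lemma gibbs_eq (R : realType) (I : finType) (p q : I -> R) :
  (forall i, 0 <= p i) -> (forall i, 0 <= q i) ->
  (forall i, q i = 0 -> p i = 0) -> \sum_i p i = \sum_i q i ->
  \sum_i p i * ln (p i / q i) <= 0 -> forall i, p i = q i.
Proof.
move=> p0 q0 ac spq sle0 i; apply/eqP.
have := @leif_sum _ _ predT _ _ _
  (fun j _ => subr_le_mul_ln (p0 j) (q0 j) (ac j)).
rewrite sumrB spq subrr => -[sge0]; rewrite eq_le sge0 sle0 => /esym/forallP.
by move=> /(_ i).
Qed.

(** * Marginals and vanishing mutual information *)

Section Law.
Variables (R : realType) (T : finType) (p : T -> R).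
Hypothesis hp : is_dist p.

Lemma law_ge0 (U : finType) (f : T -> U) u : 0 <= law p f u.
Proof. by apply: sumr_ge0 => t _; exact: hp.1. Qed.

Lemma law_sum1 (U : finType) (f : T -> U) : \sum_u law p f u = 1.
Proof. by rewrite -hp.2 (partition_big f predT). Qed.

Lemma law_fst (U V : finType) (f : T -> U) (g : T -> V) u :
  \sum_v law p (fun t => (f t, g t)) (u, v) = law p f u.
Proof. by rewrite [RHS](partition_big g predT). Qed.

Lemma law_snd (U V : finType) (f : T -> U) (g : T -> V) v :
  \sum_u law p (fun t => (f t, g t)) (u, v) = law p g v.
Proof.
rewrite [RHS](partition_big f predT)//; apply: eq_bigr => u _.
by apply: eq_bigl => t; rewrite xpair_eqE andbC.
Qed.

(** Mutual information is the divergence of the joint law from the product of its marginals, both of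
    total mass 1, so the equality case of Gibbs' inequality applies. *)
Lemma mutual_info_le0 (U V : finType) (f : T -> U) (g : T -> V) :
  mutual_info p f g <= 0 ->
  forall u v, law p (fun t => (f t, g t)) (u, v) = law p f u * law p g v.
Proof.
rewrite /mutual_info pair_bigA /= => le0 u v.
apply: (@gibbs_eq _ _ (fun w => law p (fun t => (f t, g t)) (w.1, w.2))
  (fun w => law p f w.1 * law p g w.2) _ _ _ _ le0 (u, v)).
- by move=> w; exact: law_ge0.
- by move=> w; rewrite mulr_ge0// law_ge0.
(* A vanishing marginal is a sum of nonnegative joint masses, so each of these vanishes too. *)
- move=> [u' v'] /= /eqP; rewrite mulf_eq0 => /orP[] /eqP.
  + by rewrite -(law_fst f g) => /psumr_eq0P -> // *; exact: law_ge0.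
  + by rewrite -(law_snd f g) => /psumr_eq0P -> // *; exact: law_ge0.
- rewrite -(pair_bigA _ (fun u v => law p (fun t => (f t, g t)) (u, v))) /=.
  rewrite -(pair_bigA _ (fun u v => law p f u * law p g v)) /=.
  by apply: eq_bigr => a _; rewrite law_fst -mulr_sumr law_sum1 mulr1.
Qed.

Lemma mutual_info_indep (U V : finType) (f : T -> U) (g : T -> V) :
  (forall u v, law p (fun t => (f t, g t)) (u, v) = law p f u * law p g v) ->
  mutual_info p f g = 0.
Proof.
move=> indep; rewrite /mutual_info big1// => u _; rewrite big1// => v _.
rewrite indep; have [->|nz] := eqVneq (law p f u * law p g v) 0.
  by rewrite mul0r.
by rewrite divff// ln1 mulr0.
Qed.
End Law.

(** * Inverting the channel and its tensor powers *)

Lemma not_weakly_independent_inv (R : realType) (X Y : finType)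
    (W : X -> Y -> R) :
  ~ weakly_independent W ->
  exists V : Y -> X -> R, forall x x', \sum_y W x y * V y x' = (x == x')%:R.
Proof.
move=> /negP; rewrite negbK => /(freeP (X := codom_tuple _)) freeW.
pose A := \matrix_(i < #|X|, j < #|Y|) W (enum_val i) (enum_val j).
have /row_freeP[B AB] : row_free A.
  (* A row vector that kills [A] is a vanishing linear combination of the rows of [W], hence zero by
     freeness. *)
  apply: inj_row_free => v vA0; apply/rowP => i; rewrite mxE.
  apply: (freeW (fun i => v 0 i)); apply/ffunP => y.
  rewrite sum_ffunE ffunE.
  have /rowP/(_ (enum_rank y)) := vA0; rewrite !mxE => vAy0.
  rewrite -[RHS]vAy0; apply: eq_bigr => j _.
  by rewrite nth_image !ffunE mxE enum_rankK.
exists (fun y x => B (enum_rank y) (enum_rank x)) => x x'.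
have /matrixP/(_ (enum_rank x) (enum_rank x')) := AB; rewrite !mxE.
rewrite (inj_eq enum_rank_inj) => <-.
rewrite [RHS](reindex (@enum_rank Y)); last first.
  by apply: onW_bij; exact: enum_rank_bij.
by apply: eq_bigr => y _; rewrite mxE !enum_rankK.
Qed.

Lemma tensor_rows_independent (R : realType) (X Y : finType) (W : X -> Y -> R)
    (n : nat) (a : {ffun 'I_n -> X} -> R) :
  ~ weakly_independent W ->
  (forall y : {ffun 'I_n -> Y}, \sum_x a x * \prod_i W (x i) (y i) = 0) ->
  forall x, a x = 0.
Proof.
move=> /not_weakly_independent_inv[V WV] aW0 x'.
(* Contracting with the tensor power of [V] at [x'] should single out the coefficient [a x']. *)
transitivity (\sum_(y : {ffun 'I_n -> Y})
    (\sum_x a x * \prod_i W (x i) (y i)) * \prod_i V (y i) (x' i)); last first.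
  by rewrite big1// => y _; rewrite aW0 mul0r.
under eq_bigr do rewrite mulr_suml.
(* The same factorisation serves the term at [x'] and all the others: the sum over [y] becomes the
   product over [i] of the Kronecker deltas of [x i] and [x' i]. *)
rewrite exchange_big /= (bigD1 x')//= [X in _ + X]big1 ?addr0 => [|x xx'];
  under eq_bigr do rewrite -mulrA -big_split /=;
  rewrite -mulr_sumr -(bigA_distr_bigA (fun i y => W _ y * V y (x' i)));
  under eq_bigr do rewrite WV.
  by rewrite big1 ?mulr1// => i _; rewrite eqxx.
have [i xi] : exists i, x i != x' i.
  apply/existsP; rewrite -negb_forall; apply: contra xx' => /forallP e.
  by apply/eqP/ffunP => i; exact/eqP.
by rewrite (bigD1 i)//= (negbTE xi) mul0r mulr0.
Qed.

Lemma sum_prod_marginal (R : realType) (X : finType) (n : nat) (q g : X -> R)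
    (i : 'I_n) : \sum_x q x = 1 ->
  \sum_(x : {ffun 'I_n -> X}) (\prod_j q (x j)) * g (x i) = \sum_x q x * g x.
Proof.
move=> q1.
(* Absorbing [g] into the factor at [i] makes the summand a full product, so the sum over words
   factorises. *)
transitivity (\sum_(x : {ffun 'I_n -> X})
    \prod_j (q (x j) * (if j == i then g (x j) else 1))).
  apply: eq_bigr => x _; rewrite big_split /= -[in RHS]big_mkcond /=.
  by rewrite big_pred1_eq.
rewrite -(bigA_distr_bigA (fun j x => q x * (if j == i then g x else 1))) /=.
rewrite (bigD1 i)//= eqxx [X in _ * X]big1 ?mulr1// => j /negbTE ->.
by under eq_bigr do rewrite mulr1.
Qed.

(** * Joint law of the source and the encoder output *)

Section System.
Variables (R : realType) (X Y Xhat : finType) (P : X * Y -> R) (n : nat).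
Hypothesis hP : is_dist P.
Variable f : {ffun 'I_n -> X} -> {ffun 'I_n -> Xhat} -> R.
Hypothesis hf : is_encoder f.

Let law_fstE x : law P fst x = \sum_y P (x, y).
Proof.
rewrite /law (reindex_onto (fun y => (x, y)) snd) => [|[a b] /= /eqP -> //].
by apply: eq_bigl => y; rewrite /= !eqxx.
Qed.

Lemma sum_system_law_source x z :
  \sum_(y : {ffun 'I_n -> Y}) system_law P f (x, y, z) =
  (\prod_i law P fst (x i)) * f x z.
Proof.
rewrite /system_law /source_x /source_y /output /= -mulr_suml; congr (_ * _).
under [RHS]eq_bigr do rewrite law_fstE.
by rewrite (bigA_distr_bigA (fun i y => P (x i, y))).
Qed.

Lemma sum_system (F : sample X Y Xhat n -> R) :
  \sum_w F w = \sum_z \sum_x \sum_y F (x, y, z).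
Proof.
rewrite exchange_big /=; under [RHS]eq_bigr do rewrite exchange_big /=.
by rewrite pair_bigA /= pair_bigA /=; apply: eq_bigr => -[[x y] z].
Qed.

Lemma sum_prod_source :
  \sum_(x : {ffun 'I_n -> X}) \sum_(y : {ffun 'I_n -> Y})
    \prod_i P (x i, y i) = 1.
Proof.
under eq_bigr do rewrite -(bigA_distr_bigA (fun i y => P (_ i, y))) /=.
rewrite -(bigA_distr_bigA (fun (i : 'I_n) x => \sum_y P (x, y))) /= big1//.
by move=> i _; rewrite pair_bigA /= -hP.2; apply: eq_bigr => -[].
Qed.

Lemma system_law_is_dist : is_dist (system_law P f).
Proof.
split=> [w|].
  rewrite mulr_ge0 ?(hf _).1// prodr_ge0// => i _; exact: hP.1.
rewrite sum_system exchange_big /= -sum_prod_source; apply: eq_bigr => x _.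
rewrite exchange_big /=; apply: eq_bigr => y _.
by rewrite /system_law /source_x /source_y /output /= -mulr_sumr (hf _).2 mulr1.
Qed.

Lemma law_source_output y z :
  law (system_law P f) (fun w => (source_y w, output w)) (y, z) =
  \sum_(x : {ffun 'I_n -> X}) (\prod_i P (x i, y i)) * f x z.
Proof.
rewrite /law (reindex_onto (fun x => (x, y, z)) (fun w => w.1.1)); last first.
  by move=> [[a b] d] /= /eqP[<- <-].
by apply: eq_bigl => x; rewrite /= !eqxx.
Qed.

Lemma law_source y :
  law (system_law P f) (@source_y _ _ _ n) y =
  \sum_(x : {ffun 'I_n -> X}) \prod_i P (x i, y i).
Proof.
rewrite -(law_fst _ _ (@output _ _ _ n)).
under eq_bigr do rewrite law_source_output.
rewrite exchange_big /=; apply: eq_bigr => x _.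
by rewrite -mulr_sumr (hf _).2 mulr1.
Qed.

Lemma law_output z :
  law (system_law P f) (@output _ _ _ n) z =
  \sum_(x : {ffun 'I_n -> X}) (\prod_i law P fst (x i)) * f x z.
Proof.
rewrite -(law_snd _ (@source_y _ _ _ n)).
under eq_bigr do rewrite law_source_output.
by rewrite exchange_big /=; apply: eq_bigr => x _; exact: sum_system_law_source.
Qed.

Lemma average_costE (c : X -> Xhat -> R) :
  average_cost P c f = \sum_z \sum_(x : {ffun 'I_n -> X})
    (\prod_i law P fst (x i)) * f x z * additive_cost c x z.
Proof.
rewrite /average_cost /expect sum_system.
apply: eq_bigr => z _; apply: eq_bigr => x _.
by rewrite -sum_system_law_source mulr_suml.
Qed.

Lemma leakage_le0_output_indep (W : X -> Y -> R) :
  is_cond_law P W -> ~ weakly_independent W -> leakage P f <= 0 ->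
  forall (x : {ffun 'I_n -> X}) z, (\prod_i law P fst (x i)) * f x z =
    (\prod_i law P fst (x i)) * law (system_law P f) (@output _ _ _ n) z.
Proof.
move=> [_ PW] indep /(mutual_info_le0 system_law_is_dist) eqL x z.
(* For fixed [z], the difference of the two sides, as a function of [x], is the coefficient family
   to be killed by independence of the tensor rows. *)
apply/eqP; rewrite -subr_eq0; apply/eqP; move: x.
apply: (tensor_rows_independent indep) => y.
have := eqL y z; rewrite law_source_output law_source => /eqP.
rewrite -subr_eq0 mulr_suml -sumrB => /eqP eq0; rewrite -[RHS]eq0.
apply: eq_bigr => x _.
have -> : \prod_i P (x i, y i) =
    (\prod_i law P fst (x i)) * \prod_i W (x i) (y i).
  by rewrite -big_split /=; apply: eq_bigr => i _; exact: PW.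
by rewrite mulrBl ![_ * _ * \prod_i W _ _]mulrAC.
Qed.

(** Keeping [q] general serves two uses: the output law of a zero-leakage encoder, and the point
    mass of the constant encoder. *)
Lemma average_cost_indep (c : X -> Xhat -> R) (q : {ffun 'I_n -> Xhat} -> R) :
  (forall (x : {ffun 'I_n -> X}) z, (\prod_i law P fst (x i)) * f x z =
    (\prod_i law P fst (x i)) * q z) ->
  average_cost P c f = \sum_z q z *
    (n%:R^-1 * \sum_(i < n) expect P (fun xy => c xy.1 (z i))).
Proof.
move=> fq; rewrite average_costE; apply: eq_bigr => z _.
under eq_bigr do rewrite fq mulrAC mulrC.
rewrite -mulr_sumr; congr (_ * _).
under eq_bigr do rewrite /additive_cost mulrCA mulr_sumr.
rewrite -mulr_sumr exchange_big /=; congr (_ * _); apply: eq_bigr => i _.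
rewrite (sum_prod_marginal (fun x => c x (z i)) i (law_sum1 hP _)).
rewrite /expect (eq_bigr (fun xy => P (xy.1, xy.2) * c xy.1 (z i))) => [|[]//].
rewrite -(pair_bigA _ (fun x y => P (x, y) * c x (z i))) /=.
by apply: eq_bigr => x _; rewrite law_fstE mulr_suml.
Qed.

End System.

(** * Optimality of the constant encoder *)

Lemma det_encoder_is_encoder (R : realType) (X Xhat : finType) (n : nat)
    (g : {ffun 'I_n -> X} -> {ffun 'I_n -> Xhat}) :
  is_encoder (det_encoder R g).
Proof.
move=> x; split=> [z|]; first by rewrite /det_encoder ler0n.
rewrite (bigD1 (g x))//= big1 ?addr0 /det_encoder ?eqxx// => z /negbTE.
by rewrite /det_encoder => ->.
Qed.

Theorem theorem5 (R : realType) (X Y Xhat : finType)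
  (P : X * Y -> R) (hP : is_dist P)
  (PYX : X -> Y -> R) (hPYX : is_cond_law P PYX)
  (c : X -> Xhat -> R) (hc : forall x z, 0 <= c x z)
  (xt : Xhat)
  (hxt : forall z, expect P (fun xy => c xy.1 xt) <= expect P (fun xy => c xy.1 z))
  (hwi : ~ weakly_independent PYX)
  (n : nat) (hn : (1 <= n)%N) :
  leakage P (const_encoder R n xt) = 0 /\
  average_cost P c (const_encoder R n xt) = Ca_star P c n 0.
Proof.
have enc : is_encoder (const_encoder R n xt : {ffun 'I_n -> X} -> _).
  exact: det_encoder_is_encoder.
have leak0 : leakage P (const_encoder R n xt) = 0.
  apply: mutual_info_indep => y z.
  (* The factor contributed by the constant encoder does not depend on the source word, so it leaves
     both sums. *)
  rewrite law_source_output law_source// law_output -!mulr_suml.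
  have -> : \sum_(x : {ffun 'I_n -> X}) \prod_i law P fst (x i) = 1.
    rewrite -(bigA_distr_bigA (fun (i : 'I_n) x => law P fst x)) /= big1//.
    by move=> i _; exact: law_sum1.
  by rewrite mul1r.
split => //.
have costE : average_cost P c (const_encoder R n xt) =
    expect P (fun xy => c xy.1 xt).
  rewrite (average_cost_indep hP c (q := fun z => (z == [ffun=> xt])%:R))//.
  rewrite (bigD1 [ffun=> xt])//= eqxx mul1r [X in _ + X]big1 ?addr0.
    under eq_bigr do rewrite ffunE.
    rewrite sumr_const card_ord -[X in _ * X]mulr_natl.
    by rewrite mulKf// pnatr_eq0 -lt0n.
  by move=> z /negbTE ->; rewrite mul0r.
have min_cost Gamma : strongly_achievable P c n 0 Gamma ->
    average_cost P c (const_encoder R n xt) <= Gamma.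
  move=> [f [hf fleak]]; apply: le_trans; rewrite costE.
  have indep := leakage_le0_output_indep hP hf hPYX hwi fleak.
  rewrite (average_cost_indep hP c indep).
  have distf := system_law_is_dist hP hf.
  (* Writing 1 as the total mass of the output law turns the bound into a comparison of two
     averages, term by term in [z]. *)
  rewrite -[X in X <= _]mul1r.
  rewrite -[X in X * _ <= _](law_sum1 distf (@output _ _ _ n)) mulr_suml.
  apply: ler_sum => z _; rewrite ler_wpM2l ?law_ge0//.
  rewrite ler_pdivlMl ?ltr0n// mulr_natl -[X in _ *+ X]card_ord -sumr_const.
  exact: ler_sum.
have cost_ge0 : 0 <= average_cost P c (const_encoder R n xt).
  rewrite costE; apply: sumr_ge0 => xy _; apply: mulr_ge0 => //; exact: hP.1.
have const_ach : strongly_achievable P c n 0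
    (average_cost P c (const_encoder R n xt)).
  by exists (const_encoder R n xt); split; rewrite ?leak0.
(* [inf] is meaningful here: the cost of the constant encoder lies in the set, and 0 bounds the set
   from below. *)
apply/eqP; rewrite eq_le; apply/andP; split.
  apply: lb_le_inf => [|G [_ /min_cost//]].
  by exists (average_cost P c (const_encoder R n xt)).
apply: ge_inf; last by split.
by exists 0 => G [].
Qed.
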